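(* Let $\mathbb{K}\subseteq\mathbb{C}$ be a subfield (of characteristic $0$) and let $f\in\mathbb{K}[x,y]$ be a weakly tame polynomial. Then the following are equivalent: (i) there exists a vector field $\mathcal{X}_*\in V_f$ such that the $\mathbb{K}[x,y]$-module $V_f$ is freely generated by the Hamiltonian vector field $\mathcal{X}_0=-f_y\frac{\partial}{\partial x}+f_x\frac{\partial}{\partial y}$ and $\mathcal{X}_*$ (that is, $\{\mathcal{X}_0,\mathcal{X}_*\}$ is a basis of $V_f$); (ii) $f$ belongs to the Jacobian ideal $J(f)=\langle f_x,f_y\rangle$ in $\mathbb{K}[x,y]$.
   Context: Write $f_x=\frac{\partial f}{\partial x}$, $f_y=\frac{\partial f}{\partial y}$, and $J(f)=\langle f_x,f_y\rangle\subseteq\mathbb{K}[x,y]$. The polynomial $f$ is called weakly tame if the Milnor vector space $\mathbb{K}[x,y]/J(f)$ is finite dimensional over $\mathbb{K}$. $V_f$ denotes the $\mathbb{K}[x,y]$-module of all polynomial vector fields $\mathcal{X}=P\frac{\partial}{\partial x}+Q\frac{\partial}{\partial y}$ with $P,Q\in\mathbb{K}[x,y]$ for which there exists $k\in\mathbb{K}[x,y]$ (called the cofactor) with $Pf_x+Qf_y=kf$, i.e. those admitting the curve $\{f=0\}$ as an invariant curve. *)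

(* Defs.v *)
From HB Require Import structures.
From mathcomp Require Export all_boot all_order all_algebra.
From mathcomp Require Export boolp reals complex mpoly.
From mathcomp Require Import generic_quotient ring_quotient.

Set Implicit Arguments.
Unset Strict Implicit.
Unset Printing Implicit Defensive.

Import GRing.Theory.

Local Open Scope ring_scope.
Local Open Scope quotient_scope.

(* A K-vector space is finite dimensional when it is spanned by a finite
   family; [vectType] would instead make the dimension part of the type. *)
Definition finite_dimensional (K : fieldType) (V : lmodType K) : Prop :=
  exists (n : nat) (b : 'I_n -> V),
    forall v : V, exists c : 'I_n -> K, v = \sum_(i < n) c i *: b i.

(* The submodule V of M is free with basis the family e. *)
Definition freely_generated (A : nzRingType) (M : lmodType A) (V : {pred M})
    (n : nat) (e : n.-tuple M) : Prop :=
  [/\ forall i : 'I_n, tnth e i \in V,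
      forall v : M, v \in V ->
        exists c : 'I_n -> A, v = \sum_(i < n) c i *: tnth e i &
      forall c : 'I_n -> A, \sum_(i < n) c i *: tnth e i = 0 ->
        forall i : 'I_n, c i = 0].

Section PlaneCurves.

Variable K : fieldType.
Implicit Types (f p q P Q : {mpoly K[2]}) (X : 'rV[{mpoly K[2]}]_2).

(* The variables x and y are 'X_ord0 and 'X_ord_max. *)
Definition dx f : {mpoly K[2]} := f^`M(ord0).
Definition dy f : {mpoly K[2]} := f^`M(ord_max).

Definition jacobian f : {pred {mpoly K[2]}} :=
  fun p => `[< exists a b : {mpoly K[2]}, p = a * dx f + b * dy f >].

Lemma jacobianP f p :
  reflect (exists a b : {mpoly K[2]}, p = a * dx f + b * dy f)
          (p \in jacobian f).
Proof. exact: asboolP. Qed.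

Lemma jacobian_zmod_closed f : zmod_closed (jacobian f).
Proof.
split=> [|p q /jacobianP[a [b ->]] /jacobianP[c [d ->]]]; apply/jacobianP.
  by exists 0, 0; rewrite !mul0r addr0.
by exists (a - c), (b - d); rewrite !mulrBl opprD addrACA.
Qed.

HB.instance Definition _ f :=
  GRing.isZmodClosed.Build {mpoly K[2]} (jacobian f) (jacobian_zmod_closed f).

Lemma jacobianM f p q : q \in jacobian f -> p * q \in jacobian f.
Proof.
move=> /jacobianP[a [b ->]]; apply/jacobianP.
by exists (p * a), (p * b); rewrite mulrDr !mulrA.
Qed.

(* Only the additive quotient is used: [{ideal_quot _}] would require the
   ideal to be proper, which fails when f has no critical point. *)
Definition milnor f : Type := Quotient.quot (jacobian f).

HB.instance Definition _ f := GRing.Zmodule.on (milnor f).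
HB.instance Definition _ f := ZmodQuotient.on (milnor f).

Lemma milnorW f (P : milnor f -> Prop) :
  (forall p, P (\pi_(milnor f) p)) -> forall v, P v.
Proof. by move=> Ppi v; rewrite -[v]reprK. Qed.

Lemma milnor_pi_eq f p q :
  (\pi_(milnor f) p == \pi_(milnor f) q) = (p - q \in jacobian f).
Proof. exact/esym/Quotient.idealrBE. Qed.

Definition milnor_scale f (c : K) (v : milnor f) : milnor f :=
  \pi_(milnor f) (c *: repr v).

Lemma milnor_scale_pi f (c : K) p :
  milnor_scale c (\pi_(milnor f) p) = \pi_(milnor f) (c *: p).
Proof.
apply/eqP; rewrite /milnor_scale milnor_pi_eq -scalerBr -mul_mpolyC.
by apply: jacobianM; rewrite -milnor_pi_eq reprK.
Qed.

Fact milnor_scaleA f (a b : K) (v : milnor f) :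
  milnor_scale a (milnor_scale b v) = milnor_scale (a * b) v.
Proof. by elim/milnorW: v => p; rewrite !milnor_scale_pi scalerA. Qed.

Fact milnor_scale1 f : left_id 1 (@milnor_scale f).
Proof. by elim/milnorW=> p; rewrite milnor_scale_pi scale1r. Qed.

Fact milnor_scaleDr f : right_distributive (@milnor_scale f) +%R.
Proof.
move=> a; elim/milnorW=> p; elim/milnorW=> q.
by rewrite -raddfD !milnor_scale_pi -raddfD scalerDr.
Qed.

Fact milnor_scaleDl f (v : milnor f) :
  {morph (@milnor_scale f)^~ v : a b / a + b}.
Proof.
by move=> a b /=; elim/milnorW: v => p; rewrite !milnor_scale_pi -raddfD scalerDl.
Qed.

HB.instance Definition _ f :=
  GRing.Zmodule_isLmodule.Build K (milnor f)
    (@milnor_scaleA f) (@milnor_scale1 f) (@milnor_scaleDr f)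
    (@milnor_scaleDl f).

Definition weakly_tame f : Prop := finite_dimensional (milnor f).

(* The vector field P d/dx + Q d/dy is the row vector (P, Q), so that the
   K[x,y]-module of polynomial vector fields is 'rV[{mpoly K[2]}]_2. *)
Definition vfield P Q : 'rV[{mpoly K[2]}]_2 :=
  \row_(j < 2) (if j == ord0 then P else Q).

Definition vfield_apply X f : {mpoly K[2]} :=
  X ord0 ord0 * dx f + X ord0 ord_max * dy f.

Lemma vfield_applyE P Q f : vfield_apply (vfield P Q) f = P * dx f + Q * dy f.
Proof. by rewrite /vfield_apply !mxE. Qed.

Definition invariant_vfields f : {pred 'rV[{mpoly K[2]}]_2} :=
  fun X => `[< exists k : {mpoly K[2]}, vfield_apply X f = k * f >].

Lemma invariant_vfieldsP f X :
  reflect (exists k : {mpoly K[2]}, vfield_apply X f = k * f)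
          (X \in invariant_vfields f).
Proof. exact: asboolP. Qed.

Lemma invariant_vfields_submod_closed f : submod_closed (invariant_vfields f).
Proof.
split=> [|a X Y /invariant_vfieldsP[k Xk] /invariant_vfieldsP[l Yl]];
  apply/invariant_vfieldsP.
  by exists 0; rewrite /vfield_apply !mxE !mul0r addr0.
exists (a * k + l); rewrite mulrDl -mulrA -Xk -Yl /vfield_apply !mxE.
by rewrite !mulrDl mulrDr !mulrA addrACA.
Qed.

HB.instance Definition _ f :=
  GRing.isSubmodClosed.Build {mpoly K[2]} 'rV[{mpoly K[2]}]_2
    (invariant_vfields f) (invariant_vfields_submod_closed f).

Definition hamiltonian f : 'rV[{mpoly K[2]}]_2 := vfield (- dy f) (dx f).

End PlaneCurves.

(* Main.v *)
Require Import Defs.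
From mathcomp Require Import mxpoly zify ring.

(** Write g = f_x, h = f_y and J = (g, h). What weak tameness provides is a
    regular sequence p, q inside J: the powers of one variable are linearly
    dependent modulo J, so J contains a nonzero polynomial p(x) and a nonzero
    polynomial q(y), and p(x) divides q(y) u only if it divides u
    ([weakly_tame_regular]). This property carries all the information about
    g and h that the proof uses.

    - From a basis to f in J. Every p in J is a cofactor: if p = a g + b h,
      then f (a d/dx + b d/dy) has cofactor p. The Hamiltonian field has
      cofactor 0, so the cofactor k of X_* divides every element of J. A
      common divisor of a regular sequence p, q is a unit: p = c k and
      q = d k give q c = p d, hence c = p w and w k = 1. Since k f = X_* f
      belongs to J, so does f.

    - From f in J to a basis. If f = a g + b h, then X_* = a d/dx + b d/dy
      has cofactor 1. Subtracting k X_* from a field of cofactor k leaves a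
      field that kills f, which is a multiple of the Hamiltonian one because
      the syzygies of g, h are generated by (-h, g) ([vfield_apply_eq0]).
      Applying a linear relation to f, which is not zero, shows that the
      coefficient of X_* vanishes; then so does the other one, as g and h are
      not both zero. *)

Import GRing.Theory.

Local Open Scope ring_scope.
Local Open Scope quotient_scope.

(** * Divisibility through a monic factor *)

(** A constant a that divides q u coefficientwise divides u: by descending
    induction on i, the coefficient of q u at deg q + i is u_i plus products
    involving only higher coefficients of u. *)
Lemma dvd_mul_monic (A : comNzRingType) (a : A) (q u v : {poly A}) :
  q \is monic -> q * u = a *: v -> exists w, u = a *: w.
Proof.
move=> q_monic quv.
suff dvd_coef i : exists w, u`_i = a * w.
  have [w wP] := boolp.choice dvd_coef.
  exists (\poly_(i < size u) w i); apply/polyP => i; rewrite coefZ coef_poly.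
  by case: ltnP => [_|le_ui]; [exact: wP | rewrite nth_default // mulr0].
have [k] := ubnP (size u - i); elim: k i => // k IHk i lt_k.
have [le_ui|lt_iu] := leqP (size u) i.
  by exists 0; rewrite nth_default // mulr0.
set n := (size q).-1.
have lt_n : (n < (n + i).+1)%N by rewrite ltnS leq_addr.
(* For j < n the induction hypothesis applies to u_(n + i - j), and for
   j > n the coefficient q_j vanishes. *)
have dvd_rest (j : 'I_(n + i).+1) :
    exists w, j != Ordinal lt_n -> q`_j * u`_(n + i - j) = a * w.
  have [lt_j|gt_j|eq_j] := ltngtP j n; last 1 first.
  - by exists 0 => /eqP[]; apply: val_inj.
  - have [|w ->] := IHk (n + i - j)%N; first by lia.
    by exists (q`_j * w) => _; rewrite mulrCA.
  exists 0 => _; rewrite (nth_default 0 (s := q)) ?mul0r ?mulr0 //.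
  exact: leq_trans (leqSpred _) gt_j.
have [w wP] := boolp.choice dvd_rest.
exists (v`_(n + i) - \sum_(j | j != Ordinal lt_n) w j).
rewrite mulrBr -coefZ -quv coefM (bigD1 (Ordinal lt_n)) //=.
rewrite addKn -lead_coefE (monicP q_monic) mul1r mulr_sumr.
by rewrite (eq_bigr _ wP) addrK.
Qed.

(** * Linear dependence in finite dimension *)

(** The relation is a polynomial r, so that applied to the powers of an
    element it says that r vanishes there. It comes from a nonzero vector in
    the kernel of the (n + 1) x n matrix of coordinates of e_0, ..., e_n. *)
Lemma finite_dimensional_annihilator (K : fieldType) (V : lmodType K)
    (e : nat -> V) : finite_dimensional V ->
  exists N (r : {poly K}),
    [/\ r != 0, (size r <= N)%N & \sum_(j < N) r`_j *: e j = 0].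
Proof.
move=> [n [b spanb]].
have [c cP] := boolp.choice (fun j => spanb (e j)).
pose C := \matrix_(j < n.+1, i < n) c j i.
have : kermx C != 0.
  by rewrite kermx_eq0 /row_free ltn_eqF // ltnS rank_leq_col.
case/rowV0Pn => v /sub_kermxP vC v_neq0.
exists n.+1, (rVpoly v); split.
- by apply: contra_neq v_neq0 => v0; rewrite -[v]rVpolyK v0 linear0.
- exact: size_poly.
transitivity (\sum_(i < n) (v *m C) ord0 i *: b i); last first.
  by rewrite vC big1 // => i _; rewrite mxE scale0r.
under [RHS]eq_bigr => i _ do rewrite mxE scaler_suml.
rewrite exchange_big; apply: eq_bigr => j _.
rewrite cP scaler_sumr coef_rVpoly_ord; apply: eq_bigr => i _.
by rewrite mxE scalerA.
Qed.

(** * Polynomials in the last variable *)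

Section LastVariable.

Variables (n : nat) (A : comNzRingType).

Local Notation widen := (widen_ord (leqnSn n)).

(** The inverse of [muni], which rewrites a polynomial in n + 1 variables as
    one in the last variable; it pulls divisibility back from the univariate
    setting. *)
Definition muni_inv (u : {poly {mpoly A[n]}}) : {mpoly A[n.+1]} :=
  (map_poly (@mwiden n A) u).['X_ord_max].

Lemma muni_invM : {morph muni_inv : u v / u * v}.
Proof. by move=> u v; rewrite /muni_inv rmorphM hornerM. Qed.

Lemma muniK : cancel (@muni n A) muni_inv.
Proof.
move=> p; rewrite muniE /muni_inv [RHS]mpolyE rmorph_sum horner_sum /=.
apply: eq_bigr => m _.
rewrite map_polyZ map_polyXn hornerZ hornerXn /= mwidenZ mwidenX.
rewrite -scalerAl mpolyXn -mpolyXD; congr (_ *: 'X_[_]).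
apply/mnmP => i; rewrite mnmDE mulmnE mnm1E.
have [j ->|->] := unliftP ord_max i; last first.
  by rewrite mnmwiden_ordmax eqxx mul1n.
have -> : lift ord_max j = widen j.
  by apply: val_inj; rewrite /= /bump leqNgt ltn_ord.
rewrite mnmwiden_widen mnmE -val_eqE /= gtn_eqF ?ltn_ord //.
by rewrite mul0n addn0.
Qed.

Lemma muniXwiden (i : 'I_n) :
  muni ('X_(widen i) : {mpoly A[n.+1]}) = ('X_i)%:P.
Proof.
rewrite muniE msuppX big_seq1 mcoeffX eqxx scale1r mnm1E.
rewrite -val_eqE /= ltn_eqF ?ltn_ord // expr0 alg_polyC; congr ('X_[_])%:P.
by apply/mnmP => j; rewrite mnmE !mnm1E -!val_eqE.
Qed.

Lemma muniXmax : muni ('X_ord_max : {mpoly A[n.+1]}) = 'X.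
Proof.
rewrite muniE msuppX big_seq1 mcoeffX eqxx scale1r mnm1E eqxx expr1.
rewrite (_ : [multinom _ | _ < _] = 0%MM) ?mpolyX0 ?scale1r //.
by apply/mnmP => j; rewrite mnmE mnm1E mnm0E -val_eqE /= gtn_eqF ?ltn_ord.
Qed.

End LastVariable.

(** * Polynomials in a single variable *)

Section Univariate.

Variable K : fieldType.
Implicit Types (r s : {poly K}) (f : {mpoly K[2]}).

Definition univariate {n : nat} r (i : 'I_n) : {mpoly K[n]} :=
  (map_poly (@mpolyC n K) r).['X_i].

Lemma univariateE n N r (i : 'I_n) : (size r <= N)%N ->
  univariate r i = \sum_(j < N) r`_j *: 'X_i ^+ j.
Proof.
move=> le_rN; rewrite /univariate (@horner_coef_wide _ N) ?size_map_inj_poly //.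
- by apply: eq_bigr => j _; rewrite coef_map /= mul_mpolyC.
- exact: (can_inj (@mpolyCK _ _)).
Qed.

(** Sending all the variables to 'X recovers r. *)
Lemma univariate_neq0 n r (i : 'I_n) : r != 0 -> univariate r i != 0.
Proof.
apply: contra_neq => r0.
pose h : {mpoly K[n]} -> {poly K} := mmap (@polyC K) (fun=> 'X).
suff hr : h (univariate r i) = r by rewrite -hr r0 /h rmorph0.
rewrite /h -horner_map /= -map_poly_comp mmapX mmap1U.
rewrite (eq_map_poly (g := @polyC K)); first exact: comp_polyXr.
by move=> c /=; rewrite mmapC.
Qed.

Lemma muni_univariate_widen n r (i : 'I_n) :
  muni (univariate r (widen_ord (leqnSn n) i)) = (univariate r i)%:P.
Proof.
rewrite /univariate -!horner_map /= muniXwiden -!map_poly_comp.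
by congr (_).[_]; apply: eq_map_poly => c /=; rewrite muniC.
Qed.

Lemma muni_univariate_max n r :
  muni (univariate r (@ord_max n)) = map_poly (@mpolyC n K) r.
Proof.
rewrite /univariate -horner_map /= muniXmax -map_poly_comp.
rewrite (eq_map_poly (g := polyC \o @mpolyC n K)) => [|c /=]; last exact: muniC.
by rewrite map_poly_comp; apply: comp_polyXr.
Qed.

(** Seen over the ring of polynomials in the other variables, r is a constant
    and s is monic up to a scalar, so [dvd_mul_monic] applies. *)
Lemma univariate_coprime n r s (i : 'I_n) u v : s != 0 ->
  let p := univariate r (widen_ord (leqnSn n) i) in
  univariate s ord_max * u = p * v -> exists w, u = p * w.
Proof.
move=> s_neq0 p.
wlog s_monic : s v {s_neq0} / s \is monic.
  move=> monic_case su_pv.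
  have lc_neq0 : lead_coef s != 0 by rewrite lead_coef_eq0.
  apply: (monic_case ((lead_coef s)^-1 *: s) ((lead_coef s)^-1 *: v)).
    by rewrite monicE lead_coefZ mulVf.
  rewrite /univariate map_polyZ hornerZ /= -mulrA -/(univariate s _) su_pv.
  by rewrite mul_mpolyC -scalerAr.
move=> /(congr1 (@muni n K)); rewrite !rmorphM /= muni_univariate_max.
rewrite muni_univariate_widen mul_polyC.
move=> /dvd_mul_monic[|w uw]; first exact: monic_map.
exists (muni_inv n K w).
rewrite -[u]muniK uw -mul_polyC -muni_univariate_widen -/p.
by rewrite muni_invM muniK.
Qed.

(** * Consequences of weak tameness *)

(** A linear relation between the classes of the powers of a variable in the
    finite dimensional Milnor space is a polynomial in that variable lying in
    the Jacobian ideal. *)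
Lemma weakly_tame_univariate f (i : 'I_2) :
  weakly_tame f -> exists2 r, r != 0 & univariate r i \in jacobian f.
Proof.
pose e j := \pi_(milnor f) ('X_i ^+ j).
move=> /(finite_dimensional_annihilator _ _ e)[N [r [r_neq0 le_rN sum0]]].
exists r => //.
rewrite -[univariate r i]subr0 -milnor_pi_eq raddf0 (univariateE _ _ _ i le_rN).
rewrite raddf_sum.
rewrite -[X in _ == X]sum0; apply/eqP/eq_bigr => j _.
exact/esym/milnor_scale_pi.
Qed.

Lemma weakly_tame_regular f : weakly_tame f ->
  exists p q, [/\ p \in jacobian f, q \in jacobian f, p != 0 &
    forall u v, q * u = p * v -> exists w, u = p * w].
Proof.
move=> f_tame.
pose x := widen_ord (leqnSn 1) ord0.
have [r r_neq0 rJ] := weakly_tame_univariate f x f_tame.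
have [s s_neq0 sJ] := weakly_tame_univariate f ord_max f_tame.
exists (univariate r x), (univariate s ord_max); split=> //.
  exact: univariate_neq0.
by move=> u v; apply: univariate_coprime.
Qed.

Lemma weakly_tame_neq0 f : weakly_tame f -> f != 0.
Proof.
case/weakly_tame_regular=> p [_ [/jacobianP[a [b ->]] _ + _]].
by apply: contra_neq => ->; rewrite /dx /dy !mderiv0 !mulr0 addr0.
Qed.

Lemma vfield_applyZ f c X : vfield_apply (c *: X) f = c * vfield_apply X f.
Proof. by rewrite /vfield_apply !mxE mulrDr !mulrA. Qed.

Lemma vfield_applyD f X Y :
  vfield_apply (X + Y) f = vfield_apply X f + vfield_apply Y f.
Proof. by rewrite /vfield_apply !mxE !mulrDl addrACA. Qed.

Lemma vfield_apply_hamiltonian f : vfield_apply (hamiltonian f) f = 0.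
Proof. by rewrite vfield_applyE; ring. Qed.

(** The Koszul relation generates the syzygies of g = f_x and h = f_y. Let
    P g + Q h = 0, p = a g + b h and q = c g + d h. Then p P = h u with
    u = b P - a Q, and q P = h v with v = d P - c Q, while p Q = - g u and
    q Q = - g v. Hence h and g both kill q u - p v; they are not both 0, so
    q u = p v and u = p w by regularity. Cancelling p leaves P = h w and
    Q = - g w. *)
Lemma vfield_apply_eq0 f X : weakly_tame f ->
  vfield_apply X f = 0 -> exists c, X = c *: hamiltonian f.
Proof.
move=> /weakly_tame_regular[p [q [+ + p_neq0 pq_reg]]] Xf0.
move=> /jacobianP[a [b pE]] /jacobianP[c [d qE]].
move: Xf0; rewrite /vfield_apply.
set P := X _ ord0; set Q := X _ ord_max => Xf0.
set g := dx f in pE qE Xf0 *; set h := dy f in pE qE Xf0 *.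
have PE : P * g = - (Q * h) by apply/eqP; rewrite -addr_eq0 Xf0.
pose u := b * P - a * Q; pose v := d * P - c * Q.
have hu : h * u = p * P by rewrite pE /u; ring: PE.
have gu : g * u = - (p * Q) by rewrite pE /u; ring: PE.
have hv : h * v = q * P by rewrite qE /v; ring: PE.
have gv : g * v = - (q * Q) by rewrite qE /v; ring: PE.
have h_uv : h * (q * u - p * v) = 0.
  by rewrite mulrBr !(mulrCA h) hu hv; ring.
have g_uv : g * (q * u - p * v) = 0.
  by rewrite mulrBr !(mulrCA g) gu gv; ring.
have quv : q * u = p * v.
  apply/eqP; rewrite -subr_eq0; apply: contra_neqT p_neq0 => uv_neq0.
  have/eqP := h_uv; rewrite mulf_eq0 (negPf uv_neq0) orbF => /eqP h0.
  have/eqP := g_uv; rewrite mulf_eq0 (negPf uv_neq0) orbF => /eqP g0.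
  by rewrite pE h0 g0 !mulr0 addr0.
have [w uw] := pq_reg _ _ quv.
exists (- w); apply/rowP => j; rewrite !mxE.
case: eqP => [->|/eqP j_neq0]; apply: (mulfI p_neq0).
  by rewrite -/P -hu uw; ring.
have -> : j = ord_max by apply/val_inj; move: j_neq0; case: j => [[|[|]]].
by rewrite -/Q -[LHS]opprK -gu uw; ring.
Qed.

End Univariate.

Lemma sum_pair (A : nzRingType) (M : lmodType A) (c : 'I_2 -> A) (X Y : M) :
  \sum_(i < 2) c i *: tnth [tuple X; Y] i = c ord0 *: X + c ord_max *: Y.
Proof.
by rewrite big_ord_recr big_ord1 /= !(tnth_nth 0) /=; congr (c _ *: _ + _);
  apply: val_inj.
Qed.

(** * Freeness of the module of invariant vector fields *)

Lemma hamiltonian_basis_jacobian (K : fieldType) (f : {mpoly K[2]}) :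
  weakly_tame f ->
  (exists2 Xs, Xs \in invariant_vfields f &
     freely_generated (invariant_vfields f) [tuple hamiltonian f; Xs])
  <-> f \in jacobian f.
Proof.
move=> f_tame; have f_neq0 := weakly_tame_neq0 _ f f_tame; split.
  case=> Xs /invariant_vfieldsP[k Xsk] [_ span_Xs _].
  (* f (a, b) is an invariant field of cofactor p. *)
  have k_dvd p : p \in jacobian f -> exists c, p = c * k.
    case/jacobianP=> a [b pE].
    have [|c] := span_Xs (vfield (a * f) (b * f)).
      apply/invariant_vfieldsP; exists p; rewrite vfield_applyE pE; ring.
    rewrite sum_pair => /(congr1 (fun X => vfield_apply X f)).
    rewrite vfield_applyD !vfield_applyZ vfield_apply_hamiltonian Xsk.
    rewrite vfield_applyE mulr0 add0r mulrA => pf.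
    exists (c ord_max); apply: (mulIf f_neq0); rewrite -pf pE; ring.
  have [p [q [pJ qJ p_neq0 pq_reg]]] := weakly_tame_regular _ f f_tame.
  have [c pE] := k_dvd p pJ; have [d qE] := k_dvd q qJ.
  (* A common divisor k of the regular sequence p, q is a unit. *)
  have [|w cw] := pq_reg c d; first by rewrite pE qE; ring.
  have wk : w * k = 1.
    by apply: (mulfI p_neq0); rewrite mulr1 mulrA -cw -pE.
  have kfJ : k * f \in jacobian f.
    by apply/jacobianP; exists (Xs ord0 ord0), (Xs ord0 ord_max); rewrite -Xsk.
  by have := jacobianM w kfJ; rewrite mulrA wk mul1r.
case/jacobianP=> a [b fE].
have Xsf : vfield_apply (vfield a b) f = f by rewrite vfield_applyE -fE.
have Xs_inv : vfield a b \in invariant_vfields f.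
  by apply/invariant_vfieldsP; exists 1; rewrite Xsf mul1r.
exists (vfield a b) => //; split.
- move=> i; rewrite (tnth_nth 0); case: i => [[|[|//]] /= _] //.
  apply/invariant_vfieldsP; exists 0.
  by rewrite vfield_apply_hamiltonian mul0r.
- move=> X /invariant_vfieldsP[k Xk].
  have [|c Xc] := vfield_apply_eq0 _ f (X + (- k) *: vfield a b) f_tame.
    by rewrite vfield_applyD vfield_applyZ Xk Xsf; ring.
  exists (fun i => if i == ord0 then c else k); rewrite sum_pair /= -Xc.
  by rewrite scaleNr subrK.
move=> c; rewrite sum_pair => c0.
have c1_eq0 : c ord_max = 0.
  apply: (mulIf f_neq0); move: c0 => /(congr1 (fun X => vfield_apply X f)).
  rewrite vfield_applyD !vfield_applyZ vfield_apply_hamiltonian Xsf.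
  by rewrite mulr0 add0r mul0r /vfield_apply !mxE !mul0r addr0.
have c0_eq0 : c ord0 = 0.
  move: c0; rewrite c1_eq0 scale0r addr0 => /rowP c0.
  apply: contra_neq_eq f_neq0 => c0_neq0; rewrite fE.
  have /eqP := c0 ord0; rewrite !mxE /= mulf_eq0 (negPf c0_neq0) oppr_eq0 /=.
  move=> /eqP ->.
  have /eqP := c0 ord_max; rewrite !mxE /= mulf_eq0 (negPf c0_neq0) /=.
  by move=> /eqP ->; rewrite !mulr0 addr0.
case=> [[|[|//]] lt_i2]; [rewrite -c0_eq0|rewrite -c1_eq0];
  by congr c; apply: val_inj.
Qed.

Theorem theorem1 (R : realType) (S : {pred R[i]}) (K : subFieldType S)
    (f : {mpoly K[2]}) (hf : weakly_tame f) :
  (exists2 Xs : 'rV[{mpoly K[2]}]_2,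
     Xs \in invariant_vfields f &
     freely_generated (invariant_vfields f) [tuple hamiltonian f; Xs])
  <-> f \in jacobian f.
Proof. exact: hamiltonian_basis_jacobian. Qed.
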